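(* Let $m,k$ be positive integers. For every prime power $q$, $$\delta^{\mathrm{rk}}_m(m,mk,k;q)=\frac{|\mathrm{GL}_{mk}(q)|}{(q^{mk}-1)(q^{mk}-q^m)\cdots(q^{mk}-q^{m(k-1)})\begin{bmatrix}mk\\k\end{bmatrix}_{q^m}},$$ and $$\lim_{q\to\infty}\delta^{\mathrm{rk}}_m(m,mk,k;q)=1,$$ the limit being taken over prime powers $q$ with $m,k$ fixed.
   Context: Let $q$ be a prime power. The rank $\mathrm{rk}(v)$ of $v\in\mathbb{F}_{q^m}^n$ is the dimension over $\mathbb{F}_q$ of the $\mathbb{F}_q$-span of its entries. For a nonzero $\mathbb{F}_{q^m}$-linear subspace $\mathcal{C}\le\mathbb{F}_{q^m}^n$ (a rank-metric code), its minimum distance is $d^{\mathrm{rk}}(\mathcal{C})=\min\{\mathrm{rk}(v): v\in\mathcal{C},\ v\ne 0\}$. The density function is $$\delta^{\mathrm{rk}}_d(m,n,k;q)=\frac{|\{\mathcal{C}\le\mathbb{F}_{q^m}^n : \mathcal{C}\ \mathbb{F}_{q^m}\text{-linear},\ \dim_{\mathbb{F}_{q^m}}(\mathcal{C})=k,\ d^{\mathrm{rk}}(\mathcal{C})\ge d\}|}{\begin{bmatrix}n\\k\end{bmatrix}_{q^m}},$$ where $\begin{bmatrix}n\\k\end{bmatrix}_{q^m}$ is the Gaussian binomial coefficient, i.e. the number of $k$-dimensional $\mathbb{F}_{q^m}$-subspaces of $\mathbb{F}_{q^m}^n$. $\mathrm{GL}_{mk}(q)$ is the group of invertible $mk\times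 mk$ matrices over $\mathbb{F}_q$. *)

(* Defs.v *)
From HB Require Import structures.
From mathcomp Require Import all_boot all_order all_algebra all_fingroup all_field.
From mathcomp Require Import all_classical all_reals all_analysis.

Set Implicit Arguments.
Unset Strict Implicit.
Unset Printing Implicit Defensive.

Import Order.TTheory GRing.Theory Num.Theory.
Import numFieldNormedType.Exports.

Local Open Scope ring_scope.

Definition prime_power (q : nat) : Prop :=
  exists p e : nat, [/\ prime p, (0 < e)%N & q = (p ^ e)%N].

Section FiniteVspace.
Variables (K : finFieldType) (vT : vectType K).
HB.instance Definition _ := isCountable.Build {vspace vT}
  (pcan_pickleK (can_pcan (@VectorInternalTheory.vs2mxK K vT))).
HB.instance Definition _ := fintype.isFinite.Build {vspace vT}
  (pcan_enumP (can_pcan (@VectorInternalTheory.vs2mxK K vT))).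
End FiniteVspace.

(* Meaningful for k <= n and Q > 1 only; card_vspace_dim below shows that it
   then counts subspaces. *)
Definition gauss_binom (R : fieldType) (n k Q : nat) : R :=
  \prod_(i < k) ((Q%:R ^+ n - Q%:R ^+ i) / (Q%:R ^+ k - Q%:R ^+ i)).

(* F is the field with q elements and L its extension of degree m;
   finvect_type L is L itself, equipped with its finite field structure. *)
Section RankMetric.
Variables (R : realType) (F : finFieldType) (L : fieldExtType F) (n : nat).
Local Notation K := (finvect_type L).

Definition rk (v : 'rV[K]_n) : nat :=
  \dim (<<[seq v ord0 i | i : 'I_n]>>%VS : {vspace L}).

(* Ranks are at most n, so the default value n of the iterated minimum only
   matters for the zero code, which has no minimum distance. *)
Definition min_rk_dist (C : {vspace 'rV[K]_n}) : nat :=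
  \big[minn/n]_(v : 'rV[K]_n | (v \in C) && (v != 0)) rk v.

Definition rk_density (k d : nat) : R :=
  #|[set C : {vspace 'rV[K]_n} | (\dim C == k) && (d <= min_rk_dist C)%N]|%:R
  / gauss_binom R n k #|K|.

End RankMetric.

Lemma card_free_tuple (K : finFieldType) (n k : nat) (U : {vspace 'rV[K]_n}) :
  #|[set X : k.-tuple 'rV[K]_n | free X && all [in U] X]|
    = (\prod_(i < k) (#|K| ^ \dim U - #|K| ^ i))%N.
Proof.
pose V := 'rV[K]_n; pose S j := [set X : j.-tuple V | free X && all [in U] X].
rewrite -/(S k).
elim: k => [|k IHk].
  rewrite big_ord0 -[RHS](cards1 ([tuple] : 0.-tuple V)).
  by apply: eq_card => X; rewrite [X]tuple0 !inE nil_free; apply/esym/eqP.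
rewrite big_ord_recr -{}IHk /= -!sum1_card big_distrl /=.
rewrite (reindex (fun p : k.-tuple V * V => cons_tuple p.2 p.1)) /=; last first.
  exists (fun X => (behead_tuple X, thead X)) => [[X v] _ | X _] /=.
    by congr pair; apply: val_inj.
  by rewrite [RHS]tuple_eta; apply: val_inj.
rewrite (eq_bigl (fun p => (p.1 \in S k)
   && ((p.2 \in U) && (p.2 \notin <<p.1>>%VS)))); last first.
  move=> [X v] /=; rewrite !inE /= free_cons.
  by case: (v \in U); case: (free X); case: (_ \in _); case: (all _ _).
rewrite -(pair_big_dep [in S k]
   (fun X v => (v \in U) && (v \notin <<X>>%VS)) (fun _ _ => 1%N)) /=.
apply: eq_bigr => X; rewrite inE mul1n => /andP[fX /allP sXU].
have sXU' : (<<X>> <= U)%VS by apply/span_subvP.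
have dX : \dim <<X>> = k by move: fX; rewrite /free size_tuple => /eqP.
rewrite !sum1_card -(card_vspace U) -{2}dX -card_vspace.
rewrite -(cardID [in <<X>>%VS] [in U]) /=.
rewrite (_ : #|[predI _ & _]| = #|<<X>>%VS|); last first.
  by apply: eq_card => v; rewrite !inE andb_idl // => /(subvP sXU').
by rewrite addKn; apply: eq_card => v; rewrite !inE andbC.
Qed.

Lemma card_vspace_dim (R : numFieldType) (K : finFieldType) (n k : nat) :
  (k <= n)%N ->
  #|[set U : {vspace 'rV[K]_n} | \dim U == k]|%:R = gauss_binom R n k #|K|.
Proof.
move=> lekn; pose V := 'rV[K]_n.
pose f d : nat := (\prod_(i < k) (#|K| ^ d - #|K| ^ i))%N.
have K1 : (1 < #|K|)%N by apply: finNzRing_gt1.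
have fE d : (k <= d)%N -> (f d)%:R = \prod_(i < k) (#|K|%:R ^+ d - #|K|%:R ^+ i) :> R.
  move=> lekd; rewrite natr_prod; apply: eq_bigr => i _.
  by rewrite natrB ?natrX // leq_exp2l // (leq_trans (ltnW (ltn_ord i))).
have fk_neq0 : (f k)%:R != 0 :> R.
  by rewrite pnatr_eq0 -lt0n prodn_gt0 // => i; rewrite subn_gt0 ltn_exp2l.
have dimV : \dim {: V} = n by rewrite dimvf /dim /= mul1n.
rewrite /gauss_binom prodf_div -!fE //.
apply: (mulIf fk_neq0); rewrite divfK // -natrM; congr _%:R.
transitivity #|[set X : k.-tuple V | free X && all [in {: V}%VS] X]|; last first.
  by rewrite card_free_tuple dimV.
rewrite -[RHS]sum1_card (partition_big (fun X : k.-tuple V => <<X>>%VS)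
  [in [set U : {vspace V} | \dim U == k]]) => [|X] /=; last first.
  by rewrite !inE => /andP[]; rewrite /free size_tuple => /eqP->.
rewrite -sum_nat_const; apply: eq_bigr => U; rewrite inE => /eqP dU.
have -> : f k = (\prod_(i < k) (#|K| ^ \dim U - #|K| ^ i))%N by rewrite dU.
rewrite sum1_card -card_free_tuple; apply: eq_card => X; rewrite !inE.
rewrite unfold_in inE; have -> : all [in {: V}%VS] X by apply/allP => v _; apply: memvf.
rewrite andbT /free size_tuple; case: eqP => //= dX.
rewrite eqEdim dU dX leqnn andbT.
by apply/allP/span_subvP.
Qed.

Lemma finite_ext_exists (F : finFieldType) (m : nat) :
  (0 < m)%N -> exists L : fieldExtType F, \dim {:L} = m.
Proof.
move=> m_gt0; have F1 : (1 < #|F|)%N by apply: finNzRing_gt1.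
pose N := (#|F| ^ m)%N.
have N1 : (1 < N)%N by rewrite (ltn_exp2l 0).
pose P (R : nzRingType) : {poly R} := 'X^N - 'X.
have sizeP (R : nzRingType) : size (P R) = N.+1.
  by rewrite size_polyDl size_polyXn // size_polyN size_polyX.
have /FinSplittingFieldFor[L []] : P F != 0 by rewrite -size_poly_eq0 sizeP.
rewrite rmorphB rmorphXn /= map_polyX -/(P L) => zs DP defL.
exists L.
have N0 : N%:R = 0 :> L.
  have F0 : #|F|%:R = 0 :> F by rewrite -FinRing.zmodXgE -cardsT cyclic.expg_cardG ?inE.
  by rewrite natrX -(rmorph_nat (in_alg L)) F0 rmorph0 expr0n gtn_eqF.
have Uzs : uniq zs.
  rewrite -separable_prod_XsubC -(eqp_separable DP).
  rewrite unlock /separable_poly derivB derivXn derivX -mulr_natr.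
  by rewrite -polyC_natr N0 mulr0 sub0r -scaleN1r coprimepZr ?oppr_eq0 ?oner_eq0 // coprimep1.
pose Lf := FinFieldExtType L.
suff /eq_card cL : Lf =i zs.
  have cE : #|Lf| = (#|F| ^ \dim {:L})%N.
    have := @card_vspace F Lf (Vector.class L) fullv.
    by rewrite (@card_vspacef F Lf (Vector.class L)).
  apply/eqP; rewrite -(eqn_exp2l _ _ F1) -cE cL (card_uniqP _) // -eqSS.
  by rewrite -(size_prod_XsubC zs id) -(eqp_size DP) sizeP.
have /finField_galois_generator[/= a _ Da]: (1 <= {:L})%VS by apply: sub1v.
pose Em := fixedSpace (a ^+ m)%g; rewrite dimv1 expn1 in Da.
have in_zs: zs =i Em.
  move=> z; rewrite -root_prod_XsubC -(eqp_root DP) (sameP fixedSpaceP eqP).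
  rewrite /root !hornerE subr_eq0 /= /N; congr (_ == z).
  elim: (m) => [|i IHi]; first by rewrite gal_id.
  by rewrite expgSr expnSr exprM IHi galM ?Da ?memvf.
suffices defEm: Em = {:L}%VS by move=> z; rewrite in_zs defEm memvf.
apply/eqP; rewrite eqEsubv subvf -defL -[Em]subfield_closed agenvS //.
by rewrite subv_add sub1v; apply/span_subvP=> z; rewrite in_zs.
Qed.

Lemma finite_field_models (q m : nat) :
  prime_power q -> (0 < m)%N ->
  exists (F : finFieldType) (L : fieldExtType F), #|F| = q /\ \dim {:L} = m.
Proof.
move=> [p [e [p_pr e_gt0 ->]]] m_gt0.
have [F _ cF] := pPrimePowerField p_pr e_gt0.
by have [L dL] := finite_ext_exists F m_gt0; exists F, L.
Qed.

(* Main.v *)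
(* Fix F_q-coordinates on L = F_{q^m}, and let G be a k x mk matrix over L.
   Expanding each column of G in coordinates gives an mk x mk matrix over F_q,
   and G generates a code of distance m exactly when that matrix is invertible:
   a functional s on L that kills the entries of l G, with l in L^k, is the
   functional x |-> s (sum_i l_i x_i) on L^k killing the columns of G, and for
   fixed s <> 0 every functional on L^k arises from a unique l.  Hence
   |GL_{mk}(q)| counts the codes together with an ordered basis.  For the limit,
   write the density as a quotient of products of factors 1 - q^-e, e > 0. *)
Require Import Defs.
From mathcomp Require Import all_boot all_order all_algebra all_fingroup all_field.
From mathcomp Require Import all_classical all_reals all_analysis.

Import Order.TTheory GRing.Theory Num.Theory.
Import numFieldNormedType.Exports VectorInternalTheory.

Local Open Scope ring_scope.

Set Implicit Arguments.
Unset Strict Implicit.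

(** [A] kills every column of its cokernel matrix, so injectivity on column vectors forces that
    matrix to vanish. *)
Lemma row_fullP (F : fieldType) n m (A : 'M[F]_(n, m)) :
  reflect (forall s : 'cV_m, A *m s = 0 -> s = 0) (row_full A).
Proof.
apply: (iffP idP) => [fA s As | inj].
  by apply: (row_full_inj fA); rewrite As mulmx0.
rewrite -sub1mx submxE mul1mx; apply/eqP/matrixP => i j.
have /inj/colP/(_ i) : A *m col j (cokermx A) = 0.
  by rewrite !colE mulmxA mulmx_coker mul0mx.
by rewrite !mxE.
Qed.

(** * Coordinates of [L] over [F]: rank and multiplication *)

Section CoordinateMatrices.
Variables (F : finFieldType) (L : fieldExtType F).
Local Notation K := (finvect_type L).
Local Notation dimL := (dim L).

Definition coord_mx n (v : 'rV[K]_n) : 'M[F]_(n, dimL) :=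
  \matrix_j v2r (v 0 j : L).

(** A subspace of [L] is represented by the row space of a coordinate matrix; here the generators of
    the span are exactly the rows of [coord_mx v], up to repetition. *)
Lemma rk_coord_mx n (v : 'rV[K]_n) : rk v = \rank (coord_mx v).
Proof.
rewrite /rk [@span _ _]unlock /dimv /span_expanded_def mx2vsK.
apply: eqmx_rank; apply/andP; split; apply/row_subP => i.
  rewrite rowK; have := mem_tnth i (in_tuple [seq v ord0 j | j : 'I_n]).
  by move=> /fintype.imageP[j _ ->]; apply/(eq_row_sub j); rewrite rowK.
rewrite rowK.
have /(@tnthP _ _ (in_tuple _))[j ->] : (v 0 i : L) \in [seq v ord0 j | j : 'I_n].
  exact: fintype.image_f.
by apply/(eq_row_sub j); rewrite rowK.
Qed.

(** Acts on coordinate rows from the right. On a column [s], read as a functional on [L], it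
    therefore yields the functional [y |-> s (x * y)]. *)
Definition mul_coord_mx (x : L) : 'M[F]_dimL :=
  \matrix_i v2r (x * r2v (delta_mx 0 i)).

Lemma v2r_mul (x y : L) : v2r (x * y) = v2r y *m mul_coord_mx x.
Proof.
rewrite -{1}(v2rK y) {1}(row_sum_delta (v2r y)) linear_sum /= mulr_sumr.
rewrite linear_sum mulmx_sum_row; apply: eq_bigr => i _.
by rewrite !linearZ -scalerAr linearZ rowK.
Qed.

Lemma mul_coord_mx_sub (x y : L) :
  mul_coord_mx (x - y) = mul_coord_mx x - mul_coord_mx y.
Proof. by apply/row_matrixP => i; rewrite linearB /= !rowK mulrBl linearB. Qed.

Lemma mul_coord_mx_unit (x : L) : x != 0 -> mul_coord_mx x \in unitmx.
Proof.
move=> x0; rewrite -row_free_unit; apply: inj_row_free => v Av.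
have /eqP : v2r (x * r2v v) = 0 by rewrite v2r_mul r2vK.
rewrite raddf_eq0; last exact: v2r_inj.
by rewrite mulf_eq0 (negPf x0) /= => /eqP v0; rewrite -(r2vK v) v0 linear0.
Qed.

Lemma card_finvect : #|K| = (#|F| ^ dimL)%N.
Proof.
have v2r_bij : bijective (fun x : K => v2r (x : L)).
  by exists (fun r => r2v r : K); [apply: v2rK | apply: r2vK].
by rewrite (bij_eq_card v2r_bij) card_mx mul1n.
Qed.

(** Nonzero scalars act invertibly, so the map is injective, and both sides have [#|F| ^ dimL]
    elements. Thus every functional on [L] is a unique scalar multiple of [s]. *)
Lemma mul_coord_mx_bij (s : 'cV[F]_dimL) :
  s != 0 -> bijective (fun x : K => mul_coord_mx x *m s).
Proof.
move=> s0; apply: inj_card_bij; last by rewrite card_mx muln1 card_finvect.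
move=> x y /eqP; rewrite -subr_eq0 -mulmxBl -mul_coord_mx_sub => /eqP xys.
apply/eqP; rewrite -subr_eq0; apply: contraT => /mul_coord_mx_unit uxy.
by move: s0; rewrite -(mulKmx uxy s) xys mulmx0 eqxx.
Qed.

(** * Generator matrices expanded in coordinates *)

Section Generators.
Variables (n k : nat) (X : 'I_k -> 'rV[K]_n).

(* Row j holds the coordinates of column j of the matrix with rows X. *)
Definition gen_mx : 'M[F]_(n, dimL * k) :=
  \matrix_j mxvec (\matrix_(a, i) v2r (X i 0 j : L) 0 a).

(** The columns of [C] are [k] functionals on [L], that is, one functional on [L^k]; the product
    evaluates it at each column of the matrix with rows [X]. *)
Lemma gen_mxM (C : 'M[F]_(dimL, k)) :
  gen_mx *m (mxvec C)^T = \col_j \sum_i (v2r (X i 0 j : L) *m col i C) 0 0.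
Proof.
apply/colP => j; rewrite !mxE (reindex _ (curry_mxvec_bij _ _)) /=.
under [RHS]eq_bigr do rewrite mxE.
rewrite exchange_big pair_bigA; apply: eq_bigr => -[a i] _ /=.
by rewrite [gen_mx _ _]mxE [(_^T) _ _]mxE !mxvecE !mxE.
Qed.

Lemma coord_mxM (l : {ffun 'I_k -> K}) (s : 'cV[F]_dimL) :
  coord_mx (\sum_i l i *: X i) *m s =
    gen_mx *m (mxvec (\matrix_(a, i) (mul_coord_mx (l i) *m s) a 0))^T.
Proof.
rewrite gen_mxM; apply/row_matrixP => j; apply/rowP => c; rewrite ord1 row_mul rowK.
rewrite summxE linear_sum mulmx_suml summxE !mxE; apply: eq_bigr => i _.
rewrite [(l i *: X i) 0 j]mxE /= v2r_mul -mulmxA; congr ((_ *m _) 0 0).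
by apply/colP => a; rewrite !mxE.
Qed.

Lemma row_full_gen_mx :
  row_full gen_mx <->
  forall l : {ffun 'I_k -> K}, l != 0 -> (dimL <= rk (\sum_i l i *: X i))%N.
Proof.
have dimL_gt0 : (0 < dimL)%N by rewrite -dimvf adim_gt0.
have fullE v : (dimL <= rk v)%N = row_full (coord_mx (v : 'rV[K]_n)).
  by rewrite rk_coord_mx /row_full eqn_leq rank_leq_col.
split=> [/row_fullP fG l l0 | fX].
  rewrite fullE; apply/row_fullP => s; rewrite coord_mxM => /fG/(canRL trmxK).
  rewrite trmx0 => /(canRL mxvecK); rewrite linear0 => /matrixP ls0.
  have /existsP[i li0] : [exists i, l i != 0].
    apply: contraNT l0 => /existsPn l0; apply/eqP/ffunP => i; rewrite ffunE.
    by apply/eqP; rewrite -[_ == _]negbK l0.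
  rewrite -(mulKmx (mul_coord_mx_unit li0) s).
  suff -> : mul_coord_mx (l i) *m s = 0 by rewrite mulmx0.
  by apply/colP => a; have := ls0 a i; rewrite !mxE.
(* Any nonzero functional would do here. *)
pose s : 'cV[F]_dimL := const_mx 1.
have s0 : s != 0.
  by apply/eqP => /colP/(_ (Ordinal dimL_gt0))/eqP; rewrite !mxE oner_eq0.
have [g _ gK] := mul_coord_mx_bij s0.
(* The vector [c] is unfolded into [k] functionals, each of which is a multiple of [s]; the
   multipliers form [l]. *)
apply/row_fullP => c; rewrite -(trmxK c) -(vec_mxK c^T).
set C := vec_mx _; pose l := [ffun i => g (col i C)].
have -> : C = \matrix_(a, i) (mul_coord_mx (l i) *m s) a 0.
  by apply/matrixP => a i; rewrite [RHS]mxE ffunE gK [RHS]mxE.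
(* If [l] is zero then so is [c]; otherwise [s] would be a nonzero functional killing a codeword of
   full rank. *)
rewrite -coord_mxM; case: (eqVneq l 0) => [-> _ | /fX].
  apply/eqP; rewrite trmx_eq0 mxvec_eq0; apply/eqP/matrixP => a i.
  have := mul_coord_mx_sub 0 0; rewrite !subrr => mul0.
  by rewrite mxE ffunE mul0 mul0mx !mxE.
by rewrite fullE => /row_fullP fl /fl s_eq0; rewrite s_eq0 eqxx in s0.
Qed.
End Generators.
End CoordinateMatrices.

(** The iterated minimum starts from [n], so the bound [d <= n] keeps this default value from
    interfering. *)
Lemma leq_min_rk_dist (F : finFieldType) (L : fieldExtType F) n d
    (C : {vspace 'rV[finvect_type L]_n}) :
  (d <= n)%N ->
  reflect (forall v, v \in C -> v != 0 -> (d <= rk v)%N) (d <= min_rk_dist C)%N.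
Proof.
move=> ledn; rewrite /min_rk_dist -minEnat.
apply: (iffP (@Order.TotalTheory.bigmin_geP _ nat _ n d _ _)) => [[_ dC] v Cv v0 | dC].
  by apply: dC; rewrite Cv.
by split=> // v /andP[]; apply: dC.
Qed.

(** ['GL_n] is made of matrices of size [n.-1.+1], which is [n] only for positive [n]. *)
Lemma card_GL_unitmx (F : finFieldType) n :
  (0 < n)%N -> #|'GL_n[F]%g| = #|[set A : 'M[F]_n | A \in unitmx]|.
Proof.
case: n => // n _; rewrite cardsT card_sub.
by apply: eq_card => A; rewrite !inE.
Qed.

Lemma rk0 (F : finFieldType) (L : fieldExtType F) n :
  rk (0 : 'rV[finvect_type L]_n) = 0%N.
Proof.
rewrite rk_coord_mx (_ : coord_mx _ = 0) ?mxrank0 //.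
by apply/matrixP => j a; rewrite !mxE linear0 mxE.
Qed.

(** * Double counting of codes with ordered bases *)

Section CountingCodes.
Variables (F : finFieldType) (L : fieldExtType F).
Local Notation K := (finvect_type L).
Local Notation dimL := (dim L).

Lemma gen_mx_bij n k :
  bijective (fun t : k.-tuple 'rV[K]_n => gen_mx (tnth t)).
Proof.
exists (fun A : 'M[F]_(n, dimL * k) =>
  [tuple \row_j (r2v (col i (vec_mx (row j A)))^T : K) | i < k]) => [t | A].
  apply: eq_from_tnth => i; rewrite tnth_mktuple; apply/rowP => j.
  rewrite mxE rowK mxvecK -[RHS](@v2rK _ L); congr r2v.
  by apply/rowP => a; rewrite !mxE.
apply/row_matrixP => j; rewrite rowK -[RHS]vec_mxK; congr mxvec.
apply/matrixP => a i; rewrite mxE tnth_mktuple [X in v2r X]mxE r2vK.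
by rewrite [LHS]mxE [LHS]mxE.
Qed.

Lemma card_row_full_gen_mx n k :
  #|[set t : k.-tuple 'rV[K]_n | row_full (gen_mx (tnth t))]|
    = #|[set A : 'M[F]_(n, dimL * k) | row_full A]|.
Proof.
rewrite -(on_card_preimset (f := fun t : k.-tuple 'rV[K]_n => gen_mx (tnth t))).
  by apply: eq_card => t; rewrite !inE.
exact/onW_bij/gen_mx_bij.
Qed.

Lemma card_codes n k :
  (0 < k)%N -> n = (dimL * k)%N ->
  (#|[set C : {vspace 'rV[K]_n} | (\dim C == k) && (dimL <= min_rk_dist C)]|
    * \prod_(i < k) (#|K| ^ k - #|K| ^ i) = #|'GL_n[F]%g|)%N.
Proof.
move=> k_gt0 nE; set S := [set C | _].
have dimL_gt0 : (0 < dimL)%N by rewrite -dimvf adim_gt0.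
have leLn : (dimL <= n)%N by rewrite nE leq_pmulr.
transitivity #|[set t : k.-tuple 'rV[K]_n | row_full (gen_mx (tnth t))]|; last first.
  rewrite card_row_full_gen_mx card_GL_unitmx ?nE ?muln_gt0 ?dimL_gt0 //.
  by apply: eq_card => A; rewrite !inE -row_full_unit.
have spanP (t : k.-tuple 'rV[K]_n) :
  row_full (gen_mx (tnth t)) = (free t && (<<t>>%VS \in S)).
  apply/idP/andP => [/row_full_gen_mx fX | [ft]].
    (* A nontrivial linear relation would be a combination of rank 0, below [dimL]. *)
    have ft : free t.
      apply/freeP => c ct0 i; pose l := [ffun i => c i].
      have ltE : \sum_i l i *: tnth t i = 0.
        by rewrite -[RHS]ct0; apply: eq_bigr => j _; rewrite ffunE (tnth_nth 0).
      have [/ffunP/(_ i) | /fX] := eqVneq l 0; first by rewrite !ffunE.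
      by rewrite ltE rk0 leqNgt dimL_gt0.
    split=> //; rewrite inE -[X in _ == X](size_tuple t) -/(free t) ft /=.
    apply/leq_min_rk_dist => // v /coord_span vE v0.
    pose l := [ffun i => coord t i v].
    have lE : v = \sum_i l i *: tnth t i.
      by rewrite [LHS]vE; apply: eq_bigr => i _; rewrite ffunE (tnth_nth 0).
    rewrite lE; apply: fX; apply: contraNneq v0 => l0.
    by rewrite lE l0 big1 // => i _; rewrite ffunE scale0r.
  rewrite inE => /andP[_ /leq_min_rk_dist dC]; apply/row_full_gen_mx => l l0.
  apply: dC => //.
    by apply: memv_suml => i _; apply/memvZ/memv_span/mem_tnth.
  apply: contra_neq l0 => lt0; apply/ffunP => i; rewrite ffunE.
  move/freeP: ft; apply.
  by rewrite -[RHS]lt0; apply: eq_bigr => j _; rewrite (tnth_nth 0).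
(* Tuples are grouped by their span: the fibre over a code [C] consists of its ordered bases,
   counted by [card_free_tuple]. *)
rewrite -[RHS]sum1_card (partition_big (fun t : k.-tuple 'rV[K]_n => <<t>>%VS) [in S]).
  rewrite -sum_nat_const; apply: eq_bigr => C CS.
  have dC : \dim C = k by move: CS; rewrite inE => /andP[/eqP].
  have -> : (\prod_(i < k) (#|K| ^ k - #|K| ^ i)
      = \prod_(i < k) (#|K| ^ \dim C - #|K| ^ i))%N by rewrite dC.
  rewrite sum1_card -card_free_tuple; apply: eq_card => t.
  rewrite !inE unfold_in inE spanP -andbA; apply: andb_id2l => ft.
  apply/idP/andP => [tC | [_ /eqP <-]]; last by apply/allP/span_subvP.
  have /eqP -> : <<t>>%VS == C; last by rewrite eqxx.
  rewrite eqEdim dC; move: ft; rewrite /free size_tuple => /eqP ->.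
  by rewrite leqnn andbT; apply/span_subvP/allP.
by move=> t; rewrite inE spanP => /andP[].
Qed.

End CountingCodes.

(** * The density formula and its limit *)

Lemma prime_power_gt1 q : prime_power q -> (1 < q)%N.
Proof.
by case=> p [e [pp e0 ->]]; rewrite -(expn0 p) ltn_exp2l ?prime_gt1.
Qed.

Lemma rk_density_GL (R : realType) (F : finFieldType) (L : fieldExtType F)
    m k (q := #|F|) :
  (0 < k)%N -> dim L = m ->
  rk_density R L (m * k) k m =
    #|'GL_(m * k)[F]%g|%:R /
    ((\prod_(i < k) (q%:R ^+ (m * k) - q%:R ^+ (m * i)))
     * gauss_binom R (m * k) k (q ^ m)).
Proof.
move=> k0 mE; have m0 : (0 < m)%N by rewrite -mE -dimvf adim_gt0.
have q1 : (1 < q)%N by apply: finNzRing_gt1.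
have KE : #|finvect_type L| = (q ^ m)%N by rewrite card_finvect mE.
rewrite /rk_density KE invfM mulrA; congr (_ / _).
rewrite -(@card_codes _ L _ k k0); last by rewrite mE.
rewrite mE KE natrM natr_prod.
have -> : \prod_(i < k) ((q ^ m) ^ k - (q ^ m) ^ i)%:R =
    \prod_(i < k) (q%:R ^+ (m * k) - q%:R ^+ (m * i)) :> R.
  apply: eq_bigr => i _; rewrite -!natrX -!expnM natrB // leq_exp2l //.
  by rewrite leq_mul2l ltnW ?orbT.
rewrite mulfK //; apply/prodf_neq0 => i _.
by rewrite -!natrX subr_eq0 eqr_nat eqn_exp2l // eqn_mul2l negb_or -lt0n m0 gtn_eqF.
Qed.

(** Extracting [q ^ i] from each factor [q ^ i - 1] of the order formula gives total exponent
    ['C(n, 2) + n(n+1)/2 = n * n]. *)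
Lemma card_GL_prod (R : numFieldType) (F : finFieldType) n (q := #|F|%:R : R) :
  (0 < n)%N ->
  #|'GL_n[F]%g|%:R = q ^+ (n * n) * \prod_(i < n) (1 - q^-1 ^+ i.+1).
Proof.
move=> n0; have q0 : q != 0.
  by rewrite pnatr_eq0 -lt0n ltnW // finNzRing_gt1.
rewrite card_GL // natrM natr_prod natrX -/q big_add1 /= big_mkord.
elim: n {n0} => [|n IHn]; first by rewrite !big_ord0 !mulr1 ?expr0.
rewrite !big_ord_recr /= binS bin1 exprD mulrACA IHn.
have -> : (#|F| ^ n.+1 - 1)%:R = q ^+ n.+1 * (1 - q^-1 ^+ n.+1).
  rewrite natrB ?expn_gt0 ?(ltnW (finNzRing_gt1 F)) // natrX -/q.
  by rewrite mulrBr mulr1 -exprMn divff // expr1n.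
rewrite mulrACA [X in _ * X]mulrCA mulrA mulSn mulnS !exprD.
by congr (_ * _); rewrite [RHS]mulrC [q ^+ n * _]mulrC.
Qed.

(** The first product is the denominator of the Gaussian binomial; after cancellation [q ^ (m * n)]
    is extracted from each remaining factor. *)
Lemma prod_gauss_binom (R : numFieldType) n k m (q : nat) :
  (1 < q)%N -> (0 < m)%N -> (k <= n)%N ->
  (\prod_(i < k) (q%:R ^+ (m * k) - q%:R ^+ (m * i))) * gauss_binom R n k (q ^ m)
    = q%:R ^+ (m * n * k) * \prod_(i < k) (1 - q%:R^-1 ^+ (m * (n - i))) :> R.
Proof.
move=> q1 m0 lekn; have q0 : q%:R != 0 :> R by rewrite pnatr_eq0 -lt0n ltnW.
have -> : q%:R ^+ (m * n * k) = \prod_(i < k) q%:R ^+ (m * n) :> R.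
  by rewrite prodr_const card_ord exprM.
rewrite /gauss_binom -!big_split /=.
apply: eq_bigr => i _; rewrite natrX -!exprM mulrC divfK.
  rewrite -[in (m * n)%N](subnK (leq_trans (ltnW (ltn_ord i)) lekn)) mulnDr exprD.
  by rewrite mulrBr mulr1 exprVn mulrAC divff ?mul1r // expf_neq0.
by rewrite -!natrX subr_eq0 eqr_nat eqn_exp2l // eqn_mul2l negb_or -lt0n m0 gtn_eqF.
Qed.

Lemma cvg_prod_one_minus (R : realType) T (G : set_system T) (u : T -> R) k
    (e : 'I_k -> nat) :
  Filter G -> (forall i, (0 < e i)%N) -> (u x @[x --> G] --> (0 : R))%classic ->
  (\prod_(i < k) (1 - u x ^+ e i) @[x --> G] --> (1 : R))%classic.
Proof.
move=> FG e0 u0; have prod1 : \prod_(i < k) (1 : R) = 1 by rewrite big1.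
rewrite -[X in (_ --> X)%classic]prod1.
apply: cvg_big => [|i _]; first exact: mul_continuous.
rewrite -[X in (_ --> X)%classic](subr0 1); apply: cvgB; first exact: cvg_cst.
have -> : 0 = 0 ^+ e i :> R by rewrite expr0n gtn_eqF.
apply: (@continuous_cvg _ _ _ G FG u (fun x => x ^+ e i) 0) => //.
exact: exprn_continuous.
Qed.

Local Open Scope classical_set_scope.
Local Open Scope ring_scope.

(* GF q and GFm q are any choice of models of F_q and of F_{q^m} over F_q. *)
Theorem corollary5p7 (R : realType) (m k : nat) (m_gt0 : (0 < m)%N) (k_gt0 : (0 < k)%N)
    (GF : nat -> finFieldType) (GFm : forall q, fieldExtType (GF q))
    (card_GF : forall q, prime_power q -> #|GF q| = q)
    (dim_GFm : forall q, prime_power q -> \dim {:GFm q} = m) :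
  (forall q, prime_power q ->
     rk_density R (GFm q) (m * k) k m =
       #|'GL_(m * k)[GF q]%g|%:R /
       ((\prod_(i < k) (q%:R ^+ (m * k) - q%:R ^+ (m * i)))
        * gauss_binom R (m * k) k (q ^ m))) /\
  rk_density R (GFm q) (m * k) k m @[q --> within prime_power \oo] --> (1 : R).
Proof.
have densityE q : prime_power q -> rk_density R (GFm q) (m * k) k m =
    #|'GL_(m * k)[GF q]%g|%:R /
    ((\prod_(i < k) (q%:R ^+ (m * k) - q%:R ^+ (m * i)))
     * gauss_binom R (m * k) k (q ^ m)).
  by move=> pq; rewrite rk_density_GL -?dimvf ?dim_GFm // card_GF.
split=> //.
pose num (q : nat) : R := \prod_(i < m * k) (1 - q%:R^-1 ^+ i.+1).
pose den (q : nat) : R := \prod_(i < k) (1 - q%:R^-1 ^+ (m * (m * k - i))).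
apply: (cvg_trans (fmap_within_eq (g := fun q => num q / den q) _ _)).
  move=> q; rewrite inE => pq; have q1 := prime_power_gt1 pq.
  rewrite densityE // card_GL_prod ?muln_gt0 ?m_gt0 // card_GF //.
  (* Both leading powers of [q] have exponent [(m * k) * (m * k)] and cancel. *)
  rewrite prod_gauss_binom ?leq_pmull // [(m * _ * _)%N]mulnAC -mulnA.
  by rewrite -mulf_div divff ?mul1r // expf_neq0 // pnatr_eq0 -lt0n ltnW.
(* [num] and [den] are defined for all naturals, so the limit is taken along all of them and then
   restricted. *)
apply: cvg_within_filter; rewrite -[1 in X in _ --> X]divr1.
have invq0 : (q%:R^-1 : R) @[q --> \oo] --> (0 : R).
  (* The harmonic sequence is [1 / (n + 1)], hence the shift. *)
  by rewrite -cvg_shiftS; apply: cvg_harmonic.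
apply: cvgM; last apply: cvgV; rewrite ?oner_neq0 //; apply: cvg_prod_one_minus => // i.
(* The exponents in [den] are positive since [i < k <= m * k]. *)
by rewrite muln_gt0 m_gt0 subn_gt0 (leq_trans (ltn_ord i)) // leq_pmull.
Qed.
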